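(* For all integers $n \geq r \geq 2$ and $d \geq 1$, $$e(n,r,d) \leq \binom{r}{2} + (n-r)\frac{r-1}{\gamma(d-1)}.$$
   Context: A simple undirected graph is $(2,3)$-agreeable if any three vertices induce a subgraph with at least one edge. The boxicity $\mathrm{box}(G)$ is the smallest $d\ge0$ such that $G$ is the intersection graph of a family of $d$-boxes (products of $d$ closed intervals), with the convention $\mathrm{box}(K_n)=0$. $\mathcal{G}_d(r)$ is the set of $(2,3)$-agreeable graphs with boxicity at most $d$ and clique number at most $r$; $e(n,r,d)$ is the maximal number of edges of a graph in $\mathcal{G}_d(r)$ with $n$ vertices. For $d\ge 0$, $\gamma(d)$ is the minimal agreement proportion of $(2,3)$-agreeable graphs of boxicity at most $d$, i.e. the infimum of $\omega(G)/\#V(G)$ over all such graphs $G$ (where $\omega$ is the clique number); equivalently for $d\ge1$ the infimum over $(2,3)$-agreeable arrangements of $n$ $d$-boxes of (maximal number of boxes sharing a point)$/n$. *)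

(* Defs.v *)
From HB Require Import structures.
From mathcomp Require Import all_boot all_order all_algebra.
From mathcomp Require Import boolp classical_sets set_interval reals.

Set Implicit Arguments.
Unset Strict Implicit.
Unset Printing Implicit Defensive.

Import Order.TTheory GRing.Theory Num.Theory.
Local Open Scope classical_set_scope.
Local Open Scope ring_scope.

Record sgraph (T : finType) := SGraph {
  edges : {set {set T}};
  edges_card2 : [forall e in edges, #|e| == 2%N] }.

HB.instance Definition _ (T : finType) := [isSub for @edges T].
HB.instance Definition _ (T : finType) := [Finite of sgraph T by <:].

Section Graph.
Variables (T : finType) (G : sgraph T).

Definition adj (u v : T) : bool := [set u; v]%SET \in edges G.

Definition agreeable23 : bool :=
  [forall K : {set T}, (#|K| == 3%N) ==> [exists e in edges G, e \subset K]].

Definition clique (K : {set T}) : bool :=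
  [forall u in K, forall v in K, (u != v) ==> adj u v].

Definition clique_number : nat := (\max_(K : {set T} | clique K) #|K|)%N.

End Graph.

Section Boxicity.
Variable R : realType.

(* Boxes are nonempty.  In dimension 0 the only box is the one-point space, so *)
(* the graphs represented by 0-boxes are exactly the complete ones; this       *)
(* yields the convention box(K_n) = 0.                                         *)
Definition is_box (d : nat) (B : set ('I_d -> R)) : Prop :=
  exists a b : 'I_d -> R, (forall k, a k <= b k) /\
    B = [set x : 'I_d -> R | forall k, x k \in `[a k, b k]].

Definition box_representable (T : finType) (G : sgraph T) (d : nat) : Prop :=
  exists B : T -> set ('I_d -> R), (forall v, is_box (B v)) /\
    forall u v, u != v -> (adj G u v <-> B u `&` B v !=set0).

(* One dimension per vertex w: w gets [0, 0], its neighbours [0, 1], the other *)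
(* vertices [1, 1].                                                            *)
Lemma box_representable_exists (T : finType) (G : sgraph T) :
  exists d, `[< box_representable G d >].
Proof.
have adjC u v : adj G u v = adj G v u by rewrite /adj finset.setUC.
exists #|T|; apply/asboolP.
pose a (v : T) (k : 'I_#|T|) : R :=
  if (v == enum_val k) || adj G v (enum_val k) then 0 else 1.
pose b (v : T) (k : 'I_#|T|) : R := if v == enum_val k then 0 else 1.
exists (fun v => [set x : 'I_#|T| -> R | forall k, x k \in `[a v k, b v k]]).
split=> [v|u v uv].
  exists (a v), (b v); split=> // k; rewrite /a /b.
  by case: eqVneq => //= _; case: ifP.
split=> [uvE|[x [xu xv]]].
  exists (fun k => Num.max (a u k) (a v k)); split=> k /=;
    rewrite in_itv /= le_max lexx ?orbT /= ge_max /a /b.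
    case: (eqVneq u (enum_val k)) => [<-|_] /=.
      by rewrite adjC uvE orbT lexx.
    by case: ifP => _; case: ifP => _; rewrite ?ler01 ?lexx.
  case: (eqVneq v (enum_val k)) => [<-|_] /=.
    by rewrite uvE orbT lexx.
  by case: ifP => _; case: ifP => _; rewrite ?ler01 ?lexx.
apply/negPn/negP => uvNE.
have := xu (enum_rank v); have := xv (enum_rank v).
rewrite !in_itv /= /a /b !enum_rankK eqxx (negPf uv) (negPf uvNE) /=.
by move=> /andP[_ x0] /andP[/le_trans/(_ x0)]; rewrite ler10.
Qed.

Definition boxicity (T : finType) (G : sgraph T) : nat :=
  ex_minn (box_representable_exists G).

Definition graph_class (d r : nat) (T : finType) (G : sgraph T) : bool :=
  [&& agreeable23 G, (boxicity G <= d)%N & (clique_number G <= r)%N].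

(* The value is 0 if the class contains no graph with n vertices. *)
Definition max_edges (n r d : nat) : nat :=
  (\max_(G : sgraph 'I_n | graph_class d r G) #|edges G|)%N.

(* The graph on no vertices has no clique proportion; with 0 / 0 = 0 it would *)
(* make the infimum 0.                                                        *)
Definition agreement_proportion (d : nat) : R :=
  inf [set x : R | exists (T : finType) (G : sgraph T),
    [/\ (0 < #|T|)%N, agreeable23 G, (boxicity G <= d)%N
      & x = (clique_number G)%:R / #|T|%:R]].

End Boxicity.

(* Main.v *)
Require Import Defs.
From mathcomp Require Import all_boot all_order all_algebra.
From mathcomp Require Import boolp classical_sets reals.
From mathcomp Require Import finset zify.

Import Order.TTheory GRing.Theory Num.Theory.
Local Open Scope ring_scope.

(** Consider a box whose right endpoint [t] in the last coordinate is smallest.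
    Every box meeting it contains [t] in that coordinate, so the neighbourhood
    of its vertex [v] has a representation with one dimension less.  As adding
    [v] to a clique of the neighbourhood gives a clique, [v] has degree at most
    [(r - 1) / gamma (d - 1)], and the bound follows by deleting [v] and
    iterating down to [r] vertices.

    Division by [gamma (d - 1)] is meaningful only if [gamma (d - 1) > 0].  This
    comes from the same vertex: by agreeability its non-neighbours form a
    clique, so induction on the dimension gives [gamma d >= 1 / (d + 1)]. *)

(** * Edges, agreeability and cliques *)

Section Graph.
Context {T : finType} {G : sgraph T}.

Lemma adjC u v : adj G u v = adj G v u.
Proof. by rewrite /adj setUC. Qed.

Lemma adjxx v : adj G v v = false.
Proof.
apply/negP => vv; have /forall_inP/(_ _ vv) := edges_card2 G.
by rewrite setUid cards1.
Qed.

Lemma adj_neq {u v} : adj G u v -> u != v.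
Proof. by apply: contraTneq => ->; rewrite adjxx. Qed.

Lemma edgesP {e} : e \in edges G -> exists u v, e = [set u; v]%SET /\ adj G u v.
Proof.
move=> eG; have /forall_inP/(_ _ eG)/cards2P[u [v [uv eE]]] := edges_card2 G.
by exists u, v; rewrite /adj -eE.
Qed.

Lemma card_edges_le : (#|edges G| <= 'C(#|T|, 2))%N.
Proof.
rewrite -card_draws; apply/subset_leq_card/fintype.subsetP => e eG.
by rewrite inE; have /forall_inP/(_ _ eG) := edges_card2 G.
Qed.

Lemma agreeable23_adj {u v w} : agreeable23 G ->
  u != v -> u != w -> v != w -> [|| adj G u v, adj G u w | adj G v w].
Proof.
move=> /forallP agG uv uw vw; have := agG (u |: [set v; w])%SET.
rewrite cardsU1 cards2 vw !inE negb_or uv uw => /existsP[e /andP[/edgesP]].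
move=> [x [y [-> xy]]]; rewrite subUset !sub1set !inE => /andP[].
move=> /or3P[]/eqP xE /or3P[]/eqP yE; move: xy; rewrite {}xE {}yE ?adjxx //.
all: try by move=> ->; rewrite ?orbT.
all: by rewrite adjC => ->; rewrite ?orbT.
Qed.

Lemma cliqueP {K : {set T}} : reflect
  (forall u v, u \in K -> v \in K -> u != v -> adj G u v) (clique G K).
Proof.
apply: (iffP forall_inP) => [KP u v uK vK uv|KP u uK].
  by have /forall_inP/(_ _ vK)/implyP/(_ uv) := KP u uK.
by apply/forall_inP => v vK; apply/implyP; apply: KP.
Qed.

Lemma leq_clique_number {K : {set T}} : clique G K -> (#|K| <= clique_number G)%N.
Proof. by move=> KG; rewrite /clique_number (bigD1 K) //= leq_maxl. Qed.

Lemma clique_number_leP {m} :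
  reflect (forall K, clique G K -> (#|K| <= m)%N) (clique_number G <= m)%N.
Proof. exact: bigmax_leqP. Qed.

End Graph.

(** * Induced subgraphs *)

Section InducedSubgraph.
Context {S T : finType} {f : S -> T} (f_inj : injective f) (G : sgraph T).

Lemma induced_edges_card2 :
  [forall e in [set e : {set S} | f @: e \in edges G]%SET, #|e| == 2%N].
Proof.
apply/forall_inP => e; rewrite inE => eG.
by have /forall_inP/(_ _ eG) := edges_card2 G; rewrite card_imset.
Qed.

(** Pulling back along an injection gives the subgraph its own vertex type, so that statements about
    all finite types apply to it. *)
Definition induced : sgraph S := SGraph induced_edges_card2.

Lemma adj_induced u v : adj induced u v = adj G (f u) (f v).
Proof. by rewrite /adj inE imsetU1 imset_set1. Qed.

Lemma agreeable23_induced : agreeable23 G -> agreeable23 induced.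
Proof.
move=> /forallP agG; apply/forallP => K; apply/implyP => K3.
have := agG (f @: K)%SET; rewrite card_imset // K3 => /existsP[e /andP[/edgesP]].
move=> [x [y [-> xy]]]; rewrite subUset !sub1set.
move=> /andP[/imsetP[u uK xE] /imsetP[v vK yE]].
apply/existsP; exists [set u; v]%SET; rewrite subUset !sub1set uK vK !andbT.
by rewrite -/(adj induced u v) adj_induced -xE -yE.
Qed.

Lemma clique_induced {K} : clique induced K -> clique G (f @: K).
Proof.
move=> /cliqueP KP; apply/cliqueP => _ _ /imsetP[u uK ->] /imsetP[v vK ->].
by rewrite inj_eq // -adj_induced; apply: KP.
Qed.

Lemma clique_number_induced : (clique_number induced <= clique_number G)%N.
Proof.
apply/clique_number_leP => K /clique_induced/leq_clique_number.
by rewrite card_imset.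
Qed.

End InducedSubgraph.

Definition neighborhood {T : finType} (G : sgraph T) (v : T) : sgraph {u | adj G v u} :=
  induced val_inj G.

Definition vertex_deleted {T : finType} (G : sgraph T) (v : T) : sgraph {u | u != v} :=
  induced val_inj G.

(** * Counting around a vertex *)

Section Deletion.
Context {T : finType} (G : sgraph T) (v : T).

Lemma clique_number_neighborhood :
  (clique_number (neighborhood G v) < clique_number G)%N.
Proof.
have ltK K : clique (neighborhood G v) K -> (#|K| < clique_number G)%N.
  move=> /clique_induced/cliqueP KG; rewrite -(card_imset _ val_inj).
  have vK : v \notin (val @: K)%SET.
    by apply/imsetP => -[[u vu] _ /= uE]; rewrite -uE adjxx in vu.
  (* The summand 1 is read as the truth value of [v \notin val @: K], the form in which [cardsU1]
     counts the added vertex. *)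
  rewrite -add1n -(_ : true = 1%N :> nat) // -vK -cardsU1.
  apply: leq_clique_number; apply/cliqueP => x y; rewrite !inE.
  move=> /predU1P[->|xK] /predU1P[->|yK]; rewrite ?eqxx //; last exact: KG.
    by case/imsetP: yK => -[u vu] _ ->.
  by case/imsetP: xK => -[u vu] _ ->; rewrite adjC.
(* The empty clique makes the bound positive, so the strict inequality survives taking the maximum
   over [K]. *)
have pos : (0 < clique_number G)%N.
  apply: leq_ltn_trans (ltK set0 _); first by rewrite leq0n.
  by apply/cliqueP => x; rewrite inE.
rewrite -(prednK pos) ltnS; apply/clique_number_leP => K /ltK.
by rewrite -{1}(prednK pos).
Qed.

(** An edge either contains [v], and is then determined by a neighbour of [v], or is the image of an
    edge that avoids [v]. *)
Lemma card_edges_vertex_deleted :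
  (#|edges G| <= #|edges (vertex_deleted G v)| + #|{: {u | adj G v u}}|)%N.
Proof.
pose through (u : {u | adj G v u}) := [set v; val u]%SET.
pose away (e : {set {u | u != v}}) : {set T} := (val @: e)%SET.
apply: (@leq_trans #|(away @: edges (vertex_deleted G v)) :|: (through @: setT)|%SET).
  apply/subset_leq_card/fintype.subsetP => e /edgesP[x [y [-> xy]]].
  have througho u : adj G v u -> [set v; u]%SET \in (through @: setT)%SET.
    by move=> vu; apply/imsetP; exists (exist _ u vu).
  rewrite inE; have [xv|xv] := eqVneq x v.
    by rewrite xv througho ?orbT // -xv.
  have [yv|yv] := eqVneq y v.
    by rewrite yv setUC througho ?orbT // -yv adjC.
  apply/orP; left; apply/imsetP.
  exists [set (exist _ x xv : {u | u != v}); exist _ y yv]%SET.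
    by rewrite -/(adj (vertex_deleted G v) _ _) adj_induced.
  by rewrite /away imsetU1 imset_set1.
rewrite (leq_trans (leq_card_setU _ _)) // leq_add ?leq_imset_card //.
by rewrite (leq_trans (leq_imset_card _ _)) ?cardsT.
Qed.

(** Two distinct non-neighbours of [v], both different from [v], must be adjacent, so they all form
    a clique; the successor counts [v] itself. *)
Lemma agreeable23_card : agreeable23 G ->
  (#|T| <= #|{: {u | adj G v u}}| + (clique_number G).+1)%N.
Proof.
move=> agG; pose N := [set u | adj G v u]%SET.
rewrite -(cardsC N) card_sig cardsE leq_add2l.
have vN : v \in (~: N)%SET by rewrite !inE adjxx.
rewrite (cardsD1 v) vN ltnS; apply/leq_clique_number/cliqueP => x y.
rewrite !inE => /andP[xv /negPf vx] /andP[yv /negPf vy] xy.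
by have := agreeable23_adj agG (_ : v != x) (_ : v != y) xy;
  rewrite vx vy !(eq_sym v) xv yv; apply.
Qed.

End Deletion.

(** * Boxes by their endpoints *)

Section Representation.
Context {R : realType}.

(** Coordinates are natural numbers rather than ordinals, so that changing the dimension leaves the
    endpoint functions as they are. *)
Definition interval_representation {T : finType} (G : sgraph T) (d : nat)
    (a b : T -> nat -> R) : Prop :=
  (forall v k, a v k <= b v k) /\
  forall u v, u != v -> adj G u v <->
    forall k, (k < d)%N -> a u k <= b v k /\ a v k <= b u k.

(** Boxes meet exactly when their intervals meet in each coordinate; the larger of the two left
    endpoints is then a common point. *)
Lemma box_representableP (T : finType) (G : sgraph T) d :
  box_representable R G d <-> exists a b, interval_representation G d a b.
Proof.
split=> [[B [Bbox BG]]|[a [b [ab abG]]]].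
  have [a aP] := choice Bbox; have [b abP] := choice aP.
  (* The default 0 gives the interval [0, 0] beyond dimension [d]. *)
  pose ext (c : 'I_d -> R) k := if insub k is Some i then c i else 0.
  have extE c k (kd : (k < d)%N) : ext c k = c (Ordinal kd).
    by rewrite /ext insubT.
  exists (fun v => ext (a v)), (fun v => ext (b v)); split=> [v k|u v uv].
    by rewrite /ext; case: insubP => // i _ _; apply: (abP v).1.
  rewrite BG //; split=> [[x []]|uvP].
    rewrite (abP u).2 (abP v).2 /= => xu xv k kd; rewrite !extE.
    have := xu (Ordinal kd); have := xv (Ordinal kd); rewrite !in_itv /=.
    move=> /andP[av bv] /andP[au bu].
    by split; [apply: le_trans au bv | apply: le_trans av bu].
  exists (fun k => Num.max (a u k) (a v k)).
  rewrite (abP u).2 (abP v).2 /=.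
  have abu := (abP u).1; have abv := (abP v).1.
  split=> k; have := uvP k (ltn_ord k); rewrite !extE (_ : Ordinal _ = k);
    try exact: val_inj; move=> [auv avu];
    by rewrite in_itv /= le_max lexx ?orbT ge_max ?auv ?avu ?abu ?abv.
exists (fun v => [set x : 'I_d -> R | forall k, x k \in `[a v k, b v k]%R]%classic).
split=> [v|u v uv].
  by exists (fun k => a v k), (fun k => b v k).
rewrite abG //; split=> [uvP|[x [/= xu xv]] k kd].
  exists (fun k => Num.max (a u k) (a v k)); split=> k /=;
    have [auv avu] := uvP k (ltn_ord k);
    by rewrite in_itv /= le_max lexx ?orbT ge_max ?auv ?avu ?ab.
have := xu (Ordinal kd); have := xv (Ordinal kd); rewrite !in_itv /=.
move=> /andP[av bv] /andP[au bu].
by split; [apply: le_trans au bv | apply: le_trans av bu].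
Qed.

Lemma leq_box_representable (T : finType) (G : sgraph T) c d : (c <= d)%N ->
  box_representable R G c -> box_representable R G d.
Proof.
move=> cd /box_representableP[a [b [ab abG]]]; apply/box_representableP.
pose cut (x : T -> nat -> R) v k := if (k < c)%N then x v k else 0.
exists (cut a), (cut b); rewrite /cut; split=> [v k|u v uv].
  by case: ifP.
rewrite abG //; split=> P k => [kd|kc].
  by case: ifP => // /P.
by have := P k (leq_trans kc cd); rewrite kc.
Qed.

Lemma boxicity_leP (T : finType) (G : sgraph T) d :
  (boxicity R G <= d)%N <-> box_representable R G d.
Proof.
rewrite /boxicity; case: ex_minnP => m /asboolP Gm m_min; split=> [md|Gd].
  exact: leq_box_representable Gm.
exact/m_min/asboolP.
Qed.

Lemma box_representable_induced (S T : finType) (f : S -> T) (f_inj : injective f)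
    (G : sgraph T) d :
  box_representable R G d -> box_representable R (induced f_inj G) d.
Proof.
move=> /box_representableP[a [b [ab abG]]]; apply/box_representableP.
exists (a \o f), (b \o f); split=> [v k|u v uv] /=; first exact: ab.
by rewrite adj_induced; apply: abG; rewrite inj_eq.
Qed.

Lemma box_representable_neighborhood (T : finType) (G : sgraph T) d :
  (0 < #|T|)%N -> box_representable R G d.+1 ->
  exists v, box_representable R (neighborhood G v) d.
Proof.
move=> /card_gt0P[v0 _] /box_representableP[a [b [ab abG]]].
pose v := [arg min_(w < v0) b w d]%O.
have v_min w : b v d <= b w d.
  by rewrite /v; case: arg_minP => // i _; apply.
have v_meets (u : {u | adj G v u}) : a (val u) d <= b v d.
  case: u => u /= vu; have [+ _] := abG v u (adj_neq vu).
  by move=> /(_ vu d (ltnSn d))[].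
exists v; apply/box_representableP.
exists (fun u => a (val u)), (fun u => b (val u)); split=> [u k|u w uw].
  exact: ab.
rewrite adj_induced abG //; split=> P k kd; first by apply: P; rewrite ltnW.
(* In the dropped coordinate [d] both intervals contain [b v d], so the condition holds there. *)
move: kd; rewrite ltnS leq_eqVlt => /predU1P[->|]; last exact: P.
by split; apply: le_trans (v_meets _) (v_min _).
Qed.

End Representation.

(** * Agreement proportion and the edge bound *)

Section Agreement.
Context {R : realType}.

Lemma agreeable23_card_clique d : forall (T : finType) (G : sgraph T),
  agreeable23 G -> box_representable R G d -> (#|T| <= d.+1 * clique_number G)%N.
Proof.
elim: d => [|d IHd] T G agG Grep.
  (* In dimension 0 the condition on coordinates is vacuous, so the graph is complete. *)
  rewrite mul1n -cardsT; apply/leq_clique_number/cliqueP => u v _ _ uv.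
  have /box_representableP[a [b [_ abG]]] := Grep.
  by apply/abG.
have [->//|T_gt0] := posnP #|T|.
have [v /IHd IHv] := box_representable_neighborhood _ _ _ T_gt0 Grep.
have cardN := IHv (agreeable23_induced _ _ agG).
apply: leq_trans (agreeable23_card G v agG) _.
apply: leq_trans (leq_add cardN (leqnn _)) _.
(* With w the clique number of [G], the neighbourhood has at most (d + 1)(w - 1) vertices, and
   adding w + 1 gives at most (d + 2)w. *)
have := leq_mul (leqnn d.+1) (clique_number_neighborhood G v); lia.
Qed.

Lemma agreement_proportion_gt0 d : 0 < agreement_proportion R d.
Proof.
apply: (@lt_le_trans _ _ (d.+1%:R^-1)); first by rewrite invr_gt0 ltr0n.
apply: lb_le_inf => [|_ [T [G [T_gt0 agG /boxicity_leP Grep ->]]]].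
  (* The lower bound passes to the infimum only of an inhabited set; the one-vertex graph inhabits
     it. *)
  have c2 : [forall e in set0 : {set {set unit}}, #|e| == 2%N].
    by apply/forall_inP => e; rewrite inE.
  exists ((clique_number (SGraph c2))%:R / #|{: unit}|%:R), unit, (SGraph c2).
  split; rewrite ?card_unit //.
    apply/forallP => K; apply/implyP => /eqP K3.
    by have := max_card K; rewrite K3 card_unit.
  apply/boxicity_leP/box_representableP; exists (fun _ _ => 0), (fun _ _ => 0).
  by split=> // -[] [].
rewrite ler_pdivlMr ?ltr0n // mulrC ler_pdivrMr ?ltr0n // -natrM ler_nat mulnC.
exact: agreeable23_card_clique Grep.
Qed.

Lemma card_le_agreement (T : finType) (G : sgraph T) d :
  agreeable23 G -> box_representable R G d ->
  #|T|%:R <= (clique_number G)%:R / agreement_proportion R d.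
Proof.
move=> agG Grep; have gamma_gt0 := agreement_proportion_gt0 d.
(* The empty graph does not enter the infimum and is treated apart. *)
have [->|T_gt0] := posnP #|T|; first by rewrite divr_ge0 // ltW.
rewrite ler_pdivlMr // mulrC -ler_pdivlMr ?ltr0n //; apply: ge_inf.
  by exists 0 => _ [S [H [_ _ _ ->]]]; rewrite divr_ge0.
by exists T, G; split=> //; apply/boxicity_leP.
Qed.

(** Here [m] counts the vertices still to delete. The remaining graph stays in dimension [d.+1];
    only the neighbourhood, which bounds the degree, drops to [d]. *)
Lemma card_edges_agreement d r m : forall (T : finType) (G : sgraph T),
  (0 < r)%N -> #|T| = (r + m)%N -> agreeable23 G -> box_representable R G d.+1 ->
  (clique_number G <= r)%N ->
  #|edges G|%:R <= 'C(r, 2)%:R + m%:R * ((r%:R - 1) / agreement_proportion R d).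
Proof.
have gamma_gt0 := agreement_proportion_gt0 d.
elim: m => [|m IHm] T G r_gt0 cardT agG Grep Gr.
  by rewrite mul0r addr0 ler_nat (leq_trans card_edges_le) // cardT addn0.
have T_gt0 : (0 < #|T|)%N by rewrite cardT addnS.
have [v Nrep] := box_representable_neighborhood _ _ _ T_gt0 Grep.
have degree : #|{: {u | adj G v u}}|%:R <= (r%:R - 1) / agreement_proportion R d.
  apply: le_trans (card_le_agreement _ _ _ (agreeable23_induced _ _ agG) Nrep) _.
  rewrite ler_pM2r ?invr_gt0 // lerBrDr natr1 ler_nat.
  exact: leq_trans (clique_number_neighborhood G v) Gr.
have cardD : #|{: {u | u != v}}| = (r + m)%N.
  by rewrite card_sig cardC1 cardT addnS.
have deleted := IHm _ (vertex_deleted G v) r_gt0 cardD (agreeable23_induced _ _ agG)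
  (box_representable_induced _ _ _ _ _ _ Grep)
  (leq_trans (clique_number_induced _ _) Gr).
have := card_edges_vertex_deleted G v; rewrite -(ler_nat R) natrD => edgesG.
by rewrite -natr1 mulrDl mul1r addrA (le_trans edgesG) // lerD.
Qed.

End Agreement.

Theorem theoremA4 (R : realType) (n r d : nat)
  (hr : (2 <= r)%N) (hrn : (r <= n)%N) (hd : (1 <= d)%N) :
  (max_edges R n r d)%:R <=
    'C(r, 2)%:R + (n%:R - r%:R) * ((r%:R - 1) / agreement_proportion R (d - 1))
    :> R.
Proof.
rewrite -natrB //; case: d hd => // d _; rewrite subn1 /=.
have gamma_gt0 := @agreement_proportion_gt0 R d.
rewrite /max_edges; elim/big_ind: _ => [|x y xP yP|G].
(* A maximum over an empty class is 0, so the right-hand side must be nonnegative. *)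
- by rewrite addr_ge0 // mulr_ge0 // divr_ge0 ?(ltW gamma_gt0) // subr_ge0 ler1n ltnW.
- by rewrite /maxn; case: ifP.
move=> /and3P[agG /boxicity_leP Grep Gr].
by apply: card_edges_agreement => //; rewrite ?card_ord ?subnKC // ltnW.
Qed.
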